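(* Let $k\geq 1$ and let $L$ be a vocabulary. For every $\mathrm{ESO}[k]$-sentence $\Phi$ of vocabulary $L$ there exists an $\mathrm{EXC}[k]$-sentence $\varphi$ of vocabulary $L$ such that for every $L$-model $\mathcal{M}$: \[ \mathcal{M}\models\varphi \iff \mathcal{M}\models\Phi . \]
   Context: $\mathrm{ESO}[k]$ is the $k$-ary fragment of existential second order logic: its sentences have the form $\exists P_1\dots\exists P_n\,\delta$, where $P_1,\dots,P_n$ are relation symbols of arity at most $k$ and $\delta$ is a first order sentence of vocabulary $L\cup\{P_1,\dots,P_n\}$; truth is the usual one. Team semantics. An assignment is a function from a finite set of variables into the universe $M$; a team $X$ is a set of assignments with a common domain $\mathrm{dom}(X)$. For a tuple of terms $\bar t$, $s(\bar t)$ is its value under $s$ and $X(\bar t)=\{s(\bar t)\mid s\in X\}$. For a set $A\subseteq M^k$, $X[A/\bar x]=\{s[\bar a/\bar x]\mid s\in X,\bar a\in A\}$, and for $F:X\to\mathcal{P}(M)\setminus\{\emptyset\}$, $X[F/x]=\{s[a/x]\mid s\in X, a\in F(s)\}$. First order formulas are in negation normal form (negation only in front of atomic formulas) and are evaluated as follows: a literal holds in $X$ iff it holds (in the Tarskian sense) under every $s\in X$; $\mathcal{M}\models_X\psi\wedge\theta$ iff both hold in $X$; $\mathcal{M}\models_X\psi\vee\theta$ iff there are $Y,Y'\subseteq X$ with $Y\cup Y'=X$, $\mathcal{M}\models_Y\psi$ and $\mathcal{M}\models_{Y'}\theta$; $\mathcal{M}\models_X\exists x\,\psi$ iff there is $F:X\to\mathcal{P}(M)\setminus\{\emptyset\}$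 with $\mathcal{M}\models_{X[F/x]}\psi$; $\mathcal{M}\models_X\forall x\,\psi$ iff $\mathcal{M}\models_{X[M/x]}\psi$. Exclusion logic $\mathrm{EXC}$ extends first order logic (in this team semantics) with exclusion atoms $\bar t_1\mid\bar t_2$ (for tuples of terms of equal length $m$, the atom is $m$-ary), used like literals (not negated), with $\mathcal{M}\models_X \bar t_1\mid\bar t_2$ iff $X(\bar t_1)\cap X(\bar t_2)=\emptyset$. $\mathrm{EXC}[k]$ consists of the $\mathrm{EXC}$-formulas containing only exclusion atoms of arity at most $k$. For a sentence $\varphi$, $\mathcal{M}\models\varphi$ means $\mathcal{M}\models_{\{\emptyset\}}\varphi$, where $\{\emptyset\}$ is the team containing only the empty assignment. *)

(* Defs.v *)
From mathcomp Require Import all_boot finmap.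
From mathcomp Require Import classical_sets.

Set Implicit Arguments.
Unset Strict Implicit.
Unset Printing Implicit Defensive.

Local Open Scope classical_set_scope.
Local Open Scope fset_scope.
Local Open Scope fmap_scope.
Local Open Scope nat_scope.

(* Constants are function symbols of arity 0. *)
Record vocabulary := Vocabulary {
  funsym : Type;
  fun_arity : funsym -> nat;
  relsym : Type;
  rel_arity : relsym -> nat
}.

(* [point] makes the universe nonempty; it also serves as the value of
   variables outside the domain of an assignment, a case that never arises
   when evaluating sentences at the empty assignment. *)
Record model (L : vocabulary) := Model {
  universe :> Type;
  point : universe;
  fun_interp : forall f : funsym L, (fun_arity f).-tuple universe -> universe;
  rel_interp : forall R : relsym L, set ((rel_arity R).-tuple universe)
}.

Inductive term (L : vocabulary) : Type :=
| Var of nat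
| App (f : funsym L) of ('I_(fun_arity f) -> term L).

Arguments Var {L} _.

Inductive atom (L : vocabulary) : Type :=
| Eq of term L & term L
| Rel (R : relsym L) of ('I_(rel_arity R) -> term L).

Fixpoint term_var (L : vocabulary) (x : nat) (t : term L) : bool :=
  match t with
  | Var y => x == y
  | App f ts => [exists i, term_var x (ts i)]
  end.

Definition atom_var (L : vocabulary) (x : nat) (a : atom L) : bool :=
  match a with
  | Eq t u => term_var x t || term_var x u
  | Rel R ts => [exists i, term_var x (ts i)]
  end.

Definition assignment (L : vocabulary) (M : model L) : Type := {fmap nat -> M}.

Definition upd (L : vocabulary) (M : model L)
    (s : assignment M) (x : nat) (a : M) : assignment M := s.[x <- a].

Definition empty_assignment (L : vocabulary) (M : model L) : assignment M :=
  [fmap].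

Fixpoint eval (L : vocabulary) (M : model L) (s : assignment M)
    (t : term L) : M :=
  match t with
  | Var x => odflt (point M) s.[? x]
  | App f ts => fun_interp [tuple eval s (ts i) | i < fun_arity f]
  end.

Definition eval_tuple (L : vocabulary) (M : model L) (s : assignment M)
    (n : nat) (ts : 'I_n -> term L) : n.-tuple M :=
  [tuple eval s (ts i) | i < n].

Definition atom_sat (L : vocabulary) (M : model L) (s : assignment M)
    (a : atom L) : Prop :=
  match a with
  | Eq t u => eval s t = eval s u
  | Rel R ts => rel_interp (eval_tuple s ts)
  end.

(* First order logic with Tarskian semantics; negation is unrestricted here, so
   formulas in negation normal form are a special case. *)
Inductive fo (L : vocabulary) : Type :=
| FAtom of atom L
| FNot of fo L
| FAnd of fo L & fo L
| FOr of fo L & fo L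
| FEx of nat & fo L
| FAll of nat & fo L.

Fixpoint fo_free (L : vocabulary) (x : nat) (d : fo L) : bool :=
  match d with
  | FAtom a => atom_var x a
  | FNot d1 => fo_free x d1
  | FAnd d1 d2 | FOr d1 d2 => fo_free x d1 || fo_free x d2
  | FEx y d1 | FAll y d1 => (x != y) && fo_free x d1
  end.

Fixpoint fo_sat (L : vocabulary) (M : model L) (s : assignment M)
    (d : fo L) : Prop :=
  match d with
  | FAtom a => atom_sat s a
  | FNot d1 => ~ fo_sat s d1
  | FAnd d1 d2 => fo_sat s d1 /\ fo_sat s d2
  | FOr d1 d2 => fo_sat s d1 \/ fo_sat s d2
  | FEx x d1 => exists a : M, fo_sat (upd s x a) d1
  | FAll x d1 => forall a : M, fo_sat (upd s x a) d1
  end.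

(* L + {P_0, ..., P_(n-1)}, with P_i of arity [ar i]. *)
Definition expand (L : vocabulary) (n : nat) (ar : 'I_n -> nat) : vocabulary :=
  {| funsym := funsym L;
     fun_arity := @fun_arity L;
     relsym := relsym L + 'I_n;
     rel_arity := fun R => match R with
                           | inl R0 => rel_arity R0
                           | inr i => ar i
                           end |}.

Definition expand_model (L : vocabulary) (M : model L) (n : nat)
    (ar : 'I_n -> nat) (P : forall i : 'I_n, set ((ar i).-tuple M)) :
    model (expand L ar) :=
  @Model (expand L ar) M (point M) (@fun_interp L M)
    (fun R => match R with
              | inl R0 => @rel_interp L M R0
              | inr i => P i
              end).

Record eso (L : vocabulary) := Eso {
  eso_num : nat;
  eso_arity : 'I_eso_num -> nat;
  eso_matrix : fo (expand L eso_arity)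
}.

Definition eso_sentence (L : vocabulary) (Phi : eso L) : Prop :=
  forall x : nat, ~~ fo_free x (eso_matrix Phi).

Definition eso_in (L : vocabulary) (k : nat) (Phi : eso L) : Prop :=
  forall i : 'I_(eso_num Phi), eso_arity i <= k.

Definition eso_true (L : vocabulary) (M : model L) (Phi : eso L) : Prop :=
  exists P : forall i : 'I_(eso_num Phi), set ((eso_arity i).-tuple M),
    fo_sat (empty_assignment (expand_model P)) (eso_matrix Phi).

(* [ELit b a] is the atom [a] if [b] is true and its negation otherwise;
   [EExcl t u] is the m-ary exclusion atom t | u. *)
Inductive exc (L : vocabulary) : Type :=
| ELit of bool & atom L
| EExcl (m : nat) of ('I_m -> term L) & ('I_m -> term L)
| EAnd of exc L & exc L
| EOr of exc L & exc L
| EEx of nat & exc L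
| EAll of nat & exc L.

Fixpoint exc_free (L : vocabulary) (x : nat) (p : exc L) : bool :=
  match p with
  | ELit _ a => atom_var x a
  | EExcl m t u =>
      [exists i, term_var x (t i)] || [exists i, term_var x (u i)]
  | EAnd p1 p2 | EOr p1 p2 => exc_free x p1 || exc_free x p2
  | EEx y p1 | EAll y p1 => (x != y) && exc_free x p1
  end.

Definition exc_sentence (L : vocabulary) (p : exc L) : Prop :=
  forall x : nat, ~~ exc_free x p.

Fixpoint exc_in (L : vocabulary) (k : nat) (p : exc L) : bool :=
  match p with
  | ELit _ _ => true
  | EExcl m _ _ => m <= k
  | EAnd p1 p2 | EOr p1 p2 => exc_in k p1 && exc_in k p2
  | EEx _ p1 | EAll _ p1 => exc_in k p1
  end.

(* The common-domain condition on teams is not part of the type: it holds for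
   the initial team of a sentence and is preserved by all clauses of [exc_sat]. *)
Definition team (L : vocabulary) (M : model L) : Type := set (assignment M).

Definition team_values (L : vocabulary) (M : model L) (X : team M) (m : nat)
    (ts : 'I_m -> term L) : set (m.-tuple M) :=
  [set eval_tuple s ts | s in X].

Definition team_supplement (L : vocabulary) (M : model L) (X : team M)
    (F : assignment M -> set M) (x : nat) : team M :=
  [set s' | exists s a, [/\ X s, F s a & s' = upd s x a]].

Definition team_duplicate (L : vocabulary) (M : model L) (X : team M)
    (A : set M) (x : nat) : team M :=
  [set s' | exists s a, [/\ X s, A a & s' = upd s x a]].

Fixpoint exc_sat (L : vocabulary) (M : model L) (X : team M)
    (p : exc L) : Prop :=
  match p with
  | ELit b a =>
      forall s, X s -> if b then atom_sat s a else ~ atom_sat s a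
  | EExcl m t u => team_values X t `&` team_values X u = set0
  | EAnd p1 p2 => exc_sat X p1 /\ exc_sat X p2
  | EOr p1 p2 =>
      exists Y Z : team M, [/\ Y `<=` X, Z `<=` X, Y `|` Z = X,
                               exc_sat Y p1 & exc_sat Z p2]
  | EEx x p1 =>
      exists F : assignment M -> set M,
        (forall s, X s -> F s !=set0) /\ exc_sat (team_supplement X F x) p1
  | EAll x p1 => exc_sat (team_duplicate X setT x) p1
  end%classic.

Definition exc_true (L : vocabulary) (M : model L) (p : exc L) : Prop :=
  exc_sat [set empty_assignment M]%classic p.

(* Main.v *)
(* Bring the matrix of the ESO-sentence into prenex negation normal form and
   replace each literal P(t) or ~ P(t) by an equation v = t, where v is a fresh,
   existentially quantified tuple of variables.  After the prefix, exclusion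
   atoms v | w are imposed on the whole team, for v from a positive and w from a
   negative occurrence of the same P.  From a satisfying team, P is recovered as
   the set of values of its positive tuples; the remaining matrix is a
   combination of first order literals, so it is evaluated assignment by
   assignment.  In a disjunct that fails, v takes an arbitrary value in P (or
   outside P); this requires P to be neither empty nor full, so these two cases
   are split off by a disjunction in front of the prefix. *)
Require Import Defs.
From mathcomp Require Import all_boot finmap.
From mathcomp Require Import boolp classical_sets.

Set Implicit Arguments.
Unset Strict Implicit.
Unset Printing Implicit Defensive.

(** * Total environments and agreement below a bound *)

Definition ext (T : Type) (e : nat -> T) (x : nat) (a : T) : nat -> T :=
  fun y => if y == x then a else e y.

Definition agree (T : Type) (m : nat) (e e' : nat -> T) : Prop :=
  forall x, x < m -> e x = e' x.

Lemma agree_sym (T : Type) (m : nat) (e e' : nat -> T) :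
  agree m e e' -> agree m e' e.
Proof. by move=> h x /h. Qed.

Lemma agree_ext (T : Type) (m : nat) (e e' : nat -> T) (a : T) :
  agree m.+1 (ext e m a) e' -> agree m e e'.
Proof. by move=> h x hx; rewrite -h ?ltnS 1?ltnW // /ext ltn_eqF. Qed.

Lemma agree_comp (T : Type) (m : nat) (e e' : nat -> T) (r : nat -> nat) :
  (forall x, r x < m) -> agree m e e' -> e \o r = e' \o r.
Proof. by move=> hr h; apply/funext => x /=; apply: h. Qed.

Lemma ext_lt (m : nat) (r : nat -> nat) (y : nat) :
  (forall x, r x < m) -> forall x, ext r y m x < m.+1.
Proof. by move=> hr x; rewrite /ext; case: eqP => // _; apply: ltnW; apply: hr. Qed.

(** Renaming the bound variable [x] to the fresh [m] is safe because [r] never takes the value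
    [m]. *)
Lemma ext_comp (T : Type) (m : nat) (e : nat -> T) (r : nat -> nat) x a :
  (forall x, r x < m) -> ext (e \o r) x a = ext e m a \o ext r x m.
Proof.
move=> hr; apply/funext => y; rewrite /ext /=.
by case: (y == x); rewrite ?eqxx // ltn_eqF.
Qed.

(** * Tarskian semantics over total environments *)

Definition signed (b : bool) (Q : Prop) : Prop := if b then Q else ~ Q.

Fixpoint evalf (L : vocabulary) (M : model L) (e : nat -> M) (t : term L) : M :=
  match t with
  | Var x => e x
  | App f ts => fun_interp [tuple evalf e (ts i) | i < fun_arity f]
  end.

Definition atomf (L : vocabulary) (M : model L) (e : nat -> M) (a : atom L) :
    Prop :=
  match a with
  | Eq t u => evalf e t = evalf e u
  | Rel R ts => rel_interp [tuple evalf e (ts i) | i < rel_arity R]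
  end.

Fixpoint fsat (L : vocabulary) (M : model L) (e : nat -> M) (d : fo L) : Prop :=
  match d with
  | FAtom a => atomf e a
  | FNot d1 => ~ fsat e d1
  | FAnd d1 d2 => fsat e d1 /\ fsat e d2
  | FOr d1 d2 => fsat e d1 \/ fsat e d2
  | FEx x d1 => exists a : M, fsat (ext e x a) d1
  | FAll x d1 => forall a : M, fsat (ext e x a) d1
  end.

Lemma evalf_eq (L : vocabulary) (M : model L) (e e' : nat -> M) (t : term L) :
  (forall x, term_var x t -> e x = e' x) -> evalf e t = evalf e' t.
Proof.
elim: t => [y|f ts IH] /= h; first by apply: h; rewrite eqxx.
congr fun_interp; apply: eq_mktuple => i; apply: IH => x hx; apply: h.
by apply/existsP; exists i.
Qed.

Lemma atomf_eq (L : vocabulary) (M : model L) (e e' : nat -> M) (a : atom L) :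
  (forall x, atom_var x a -> e x = e' x) -> atomf e a = atomf e' a.
Proof.
case: a => [t u|R ts] /= h.
  by congr (_ = _); apply: evalf_eq => x hx; apply: h; rewrite hx ?orbT.
congr rel_interp; apply: eq_mktuple => i; apply: evalf_eq => x hx; apply: h.
by apply/existsP; exists i.
Qed.

Lemma fsat_eq (L : vocabulary) (M : model L) (d : fo L) (e e' : nat -> M) :
  (forall x, fo_free x d -> e x = e' x) -> fsat e d <-> fsat e' d.
Proof.
elim: d e e' => [a|d IH|d1 IH1 d2 IH2|d1 IH1 d2 IH2|y d IH|y d IH] e e' /= h.
- by rewrite (atomf_eq h).
- by have := IH e e' h; tauto.
- have := IH1 e e'; have := IH2 e e'.
  by case=> [x hx|? ?]; [|case=> [x hx|? ?]; [|tauto]];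
    apply: h; rewrite hx ?orbT.
- have := IH1 e e'; have := IH2 e e'.
  by case=> [x hx|? ?]; [|case=> [x hx|? ?]; [|tauto]];
    apply: h; rewrite hx ?orbT.
- have {}IH a : fsat (ext e y a) d <-> fsat (ext e' y a) d.
    apply: IH => x hx; rewrite /ext; case: eqP => // /eqP xy.
    by apply: h; rewrite xy.
  by split=> -[a /IH ?]; exists a.
- have {}IH a : fsat (ext e y a) d <-> fsat (ext e' y a) d.
    apply: IH => x hx; rewrite /ext; case: eqP => // /eqP xy.
    by apply: h; rewrite xy.
  by split=> hd a; apply/IH.
Qed.

(** The default [point] is the one that [eval] uses, so domains need not be tracked from here on. *)
Definition env (L : vocabulary) (M : model L) (s : assignment M) : nat -> M :=
  fun x => odflt (Defs.point M) (fnd s x).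

Lemma env_upd (L : vocabulary) (M : model L) (s : assignment M) x a :
  env (upd s x a) = ext (env s) x a.
Proof. by apply/funext => y; rewrite /env /upd fnd_set /ext; case: eqP. Qed.

Lemma eval_env (L : vocabulary) (M : model L) (s : assignment M) (t : term L) :
  eval s t = evalf (env s) t.
Proof. by elim: t => //= f ts IH; congr fun_interp; apply: eq_mktuple. Qed.

Lemma atom_sat_env (L : vocabulary) (M : model L) (s : assignment M) a :
  atom_sat s a = atomf (env s) a.
Proof.
case: a => [t u|R ts] /=; first by rewrite !eval_env.
by congr rel_interp; apply: eq_mktuple => i; apply: eval_env.
Qed.

Lemma fo_sat_env (L : vocabulary) (M : model L) (d : fo L) (s : assignment M) :
  fo_sat s d <-> fsat (env s) d.
Proof.
elim: d s => [a|d IH|d1 IH1 d2 IH2|d1 IH1 d2 IH2|y d IH|y d IH] s /=.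
- by rewrite atom_sat_env.
- by have := IH s; tauto.
- by have := IH1 s; have := IH2 s; tauto.
- by have := IH1 s; have := IH2 s; tauto.
- split=> -[a h]; exists a; first by rewrite -env_upd; apply/IH.
  by apply/IH; rewrite env_upd.
- split=> h a; first by rewrite -env_upd; apply/IH.
  by apply/IH; rewrite env_upd.
Qed.

(** * Flatness of formulas built from literals *)

Fixpoint literal_only (L : vocabulary) (p : exc L) : bool :=
  match p with
  | ELit _ _ => true
  | EAnd p1 p2 | EOr p1 p2 => literal_only p1 && literal_only p2
  | _ => false
  end.

Fixpoint qsat (L : vocabulary) (M : model L) (e : nat -> M) (p : exc L) : Prop :=
  match p with
  | ELit b a => signed b (atomf e a)
  | EAnd p1 p2 => qsat e p1 /\ qsat e p2
  | EOr p1 p2 => qsat e p1 \/ qsat e p2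
  | _ => True
  end.

Lemma qsat_eq (L : vocabulary) (M : model L) (p : exc L) (e e' : nat -> M) :
  (forall x, exc_free x p -> e x = e' x) -> qsat e p -> qsat e' p.
Proof.
elim: p => //= [b a h|p IHp q IHq h [hp hq]|p IHp q IHq h [hp|hq]].
- by rewrite (atomf_eq h).
- by split; [apply: IHp hp|apply: IHq hq] => x hx; apply: h; rewrite hx ?orbT.
- by left; apply: IHp hp => x hx; apply: h; rewrite hx.
- by right; apply: IHq hq => x hx; apply: h; rewrite hx orbT.
Qed.

Lemma exc_sat_literal_only (L : vocabulary) (M : model L) (p : exc L)
    (X : team M) :
  literal_only p ->
  exc_sat X p <-> forall s, X s -> qsat (env s) p.
Proof.
elim: p X => //= [b a X _|p IHp q IHq X /andP[lp lq]|p IHp q IHq X /andP[lp lq]].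
- by split=> h s /h; rewrite atom_sat_env; case: b {h}.
- split=> [[/(IHp _ lp) hp /(IHq _ lq) hq] s Xs|h]; first by split; auto.
  by split; [apply/(IHp _ lp)|apply/(IHq _ lq)] => s /h [].
- split=> [[Y [Z [_ _ <- /(IHp _ lp) hp /(IHq _ lq) hq]]] s [Ys|Zs]|h].
  + by left; apply: hp.
  + by right; apply: hq.
  (* The team is split by the disjunct that each assignment satisfies; the two parts may overlap. *)
  + exists [set s | X s /\ qsat (env s) p]%classic.
    exists [set s | X s /\ qsat (env s) q]%classic; split.
    * by move=> s [].
    * by move=> s [].
    * by apply/seteqP; split=> [s [] []|s Xs] //; case: (h s Xs); [left|right].
    * by apply/(IHp _ lp) => s [].
    * by apply/(IHq _ lq) => s [].
Qed.

(** * Finite conjunctions and disjunctions *)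

Definition ETrue (L : vocabulary) : exc L := ELit true (Eq (Var 0) (Var 0)).
Definition EFalse (L : vocabulary) : exc L := ELit false (Eq (Var 0) (Var 0)).

Definition exc_all (L : vocabulary) (T : Type) (f : T -> exc L) (s : seq T) :=
  foldr (fun x => EAnd (f x)) (ETrue L) s.

Definition exc_any (L : vocabulary) (T : Type) (f : T -> exc L) (s : seq T) :=
  foldr (fun x => EOr (f x)) (EFalse L) s.

(** The case [x = 0] comes from [ETrue]: the syntax has no truth constant, so it is written with
    variable 0. *)
Lemma exc_free_all (L : vocabulary) (T : eqType) (f : T -> exc L) s x :
  exc_free x (exc_all f s) -> x = 0 \/ exists2 y, y \in s & exc_free x (f y).
Proof.
elim: s => [|y s IH] /=; first by rewrite orbb => /eqP; left.
case/orP => [h|/IH [->|[z zs hz]]]; [right; exists y|left|right; exists z] => //.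
  by rewrite mem_head.
by rewrite inE zs orbT.
Qed.

Lemma exc_free_any (L : vocabulary) (T : eqType) (f : T -> exc L) s x :
  exc_free x (exc_any f s) -> x = 0 \/ exists2 y, y \in s & exc_free x (f y).
Proof.
elim: s => [|y s IH] /=; first by rewrite orbb => /eqP; left.
case/orP => [h|/IH [->|[z zs hz]]]; [right; exists y|left|right; exists z] => //.
  by rewrite mem_head.
by rewrite inE zs orbT.
Qed.

Lemma exc_in_all (L : vocabulary) (T : Type) (f : T -> exc L) s k :
  (forall x, exc_in k (f x)) -> exc_in k (exc_all f s).
Proof. by move=> h; elim: s => //= x s ->; rewrite h. Qed.

Lemma exc_in_any (L : vocabulary) (T : Type) (f : T -> exc L) s k :
  (forall x, exc_in k (f x)) -> exc_in k (exc_any f s).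
Proof. by move=> h; elim: s => //= x s ->; rewrite h. Qed.

Lemma exc_in_literal_only (L : vocabulary) (p : exc L) k :
  literal_only p -> exc_in k p.
Proof. by elim: p => //= p IHp q IHq /andP[/IHp -> /IHq ->]. Qed.

Lemma exc_sat_all (L : vocabulary) (M : model L) (X : team M) (T : eqType)
    (f : T -> exc L) s :
  exc_sat X (exc_all f s) <-> forall x, x \in s -> exc_sat X (f x).
Proof.
elim: s => [|y s IH] /=; first by split.
split=> [[hy /IH hs] x|h]; first by rewrite inE => /predU1P[->|/hs].
by split; [|apply/IH => x xs]; apply: h; rewrite inE ?eqxx ?xs ?orbT.
Qed.

Lemma qsat_all (L : vocabulary) (M : model L) (e : nat -> M) (T : eqType)
    (f : T -> exc L) s :
  qsat e (exc_all f s) <-> forall x, x \in s -> qsat e (f x).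
Proof.
elim: s => [|y s IH] /=; first by split.
split=> [[hy /IH hs] x|h]; first by rewrite inE => /predU1P[->|/hs].
by split; [|apply/IH => x xs]; apply: h; rewrite inE ?eqxx ?xs ?orbT.
Qed.

(** The empty team property lets one disjunct of [exc_any] take the whole team. *)
Lemma exc_sat_set0 (L : vocabulary) (M : model L) (p : exc L) :
  exc_sat (@set0 (assignment M)) p.
Proof.
elim: p => //=.
- by move=> m t u; apply/seteqP; split=> // x [[s []]].
- by move=> p hp q hq; exists set0, set0; split=> //; rewrite setU0.
- move=> x p hp; exists (fun=> setT); split=> //.
  suff -> : team_supplement set0 (fun _ : assignment M => setT) x = set0 by [].
  by apply/seteqP; split=> // s [? [? []]].
- move=> x p hp.
  suff -> : team_duplicate (@set0 (assignment M)) setT x = set0 by [].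
  by apply/seteqP; split=> // s [? [? []]].
Qed.

Lemma exc_sat_any_intro (L : vocabulary) (M : model L) (X : team M)
    (T : eqType) (f : T -> exc L) s x :
  x \in s -> exc_sat X (f x) -> exc_sat X (exc_any f s).
Proof.
elim: s => //= y s IH; rewrite inE => /predU1P[-> h|xs h].
  exists X, set0; split=> //; rewrite ?setU0 //; exact: exc_sat_set0.
exists set0, X; split=> //; rewrite ?set0U //; first exact: exc_sat_set0.
exact: IH.
Qed.

(** Disjunction splits the team, so a disjunct is only known to hold in some nonempty subteam; one
    assignment from it is enough for a sentence. *)
Lemma exc_sat_any_elim (L : vocabulary) (M : model L) (T : eqType)
    (f : T -> exc L) s (X : team M) :
  (X !=set0)%classic -> exc_sat X (exc_any f s) ->
  exists x (Y : team M), (Y !=set0)%classic /\ exc_sat Y (f x).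
Proof.
elim: s X => /= [|y s IH] X [s0 Xs0]; first by move/(_ _ Xs0).
case=> Y [Z [_ _ eX hY hZ]]; move: Xs0; rewrite -eX => -[Ys|Zs].
  by exists y, Y; split=> //; exists s0.
by apply: (IH Z) => //; exists s0.
Qed.

(** * Quantifier prefixes in team and Tarskian semantics *)

(* A prefix lists the quantifiers binding the consecutive variables m, m+1, ...;
   [true] stands for a universal quantifier. *)
Fixpoint quantify (L : vocabulary) (p : seq bool) (m : nat) (q : exc L) : exc L :=
  match p with
  | [::] => q
  | true :: p' => EAll m (quantify p' m.+1 q)
  | false :: p' => EEx m (quantify p' m.+1 q)
  end.

Fixpoint psat (T : Type) (p : seq bool) (m : nat) (G : (nat -> T) -> Prop)
    (e : nat -> T) : Prop :=
  match p with
  | [::] => G e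
  | true :: p' => forall a, psat p' m.+1 G (ext e m a)
  | false :: p' => exists a, psat p' m.+1 G (ext e m a)
  end.

Lemma exc_free_quantify (L : vocabulary) (p : seq bool) m (q : exc L) :
  (forall x, exc_free x q -> x < m + size p) ->
  forall x, exc_free x (quantify p m q) -> x < m.
Proof.
elim: p m => [|b p IH] m /=; first by rewrite addn0.
rewrite addnS -addSn => /IH h x.
have {}h : (x != m) && exc_free x (quantify p m.+1 q) -> x < m.
  by case/andP=> xm /h; rewrite ltnS leq_eqVlt (negbTE xm).
by case: b.
Qed.

Lemma exc_in_quantify (L : vocabulary) (p : seq bool) m (q : exc L) k :
  exc_in k (quantify p m q) = exc_in k q.
Proof. by elim: p m => //= -[] p IH m /=. Qed.

(** [Y] is the team that the prefix produces from [X]. It is fixed before [G], because [G] will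
    speak of relations read off from [Y]. *)
Lemma exc_sat_quantify_elim (L : vocabulary) (M : model L) (p : seq bool) m
    (q : exc L) (X : team M) :
  exc_sat X (quantify p m q) ->
  exists2 Y : team M, exc_sat Y q &
    forall G, (forall s, Y s -> G (env s)) ->
      forall s, X s -> psat p m G (env s).
Proof.
elim: p m X => [|b p IH] m X /=; first by move=> h; exists X.
case: b => /= [/IH[Y hY hG]|[F [hF /IH[Y hY hG]]]]; exists Y => // G /hG h s Xs.
  by move=> a; rewrite -env_upd; apply: h; exists s, a.
have [a Fa] := hF s Xs; exists a; rewrite -env_upd; apply: h.
by exists s, a.
Qed.

Lemma exc_sat_quantify_intro (L : vocabulary) (M : model L) (p : seq bool) m
    (q : exc L) (G : (nat -> M) -> Prop) (X : team M) :
  (forall Y : team M, (forall s, Y s -> G (env s)) -> exc_sat Y q) ->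
  (forall s, X s -> psat p m G (env s)) -> exc_sat X (quantify p m q).
Proof.
move=> hq; elim: p m X => [|b p IH] m X /=; first exact: hq.
case: b => /= h.
  by apply: IH => _ [s [a [Xs _ ->]]]; rewrite env_upd; apply: h.
(* All good witnesses are supplied at once, which avoids choosing one for each assignment. *)
exists (fun s => [set a | psat p m.+1 G (ext (env s) m a)]%classic); split.
  by move=> s /h.
by apply: IH => _ [s [a [Xs Fa ->]]]; rewrite env_upd.
Qed.

Lemma psat_cat (T : Type) (p q : seq bool) m G (e : nat -> T) :
  psat (p ++ q) m G e = psat p m (psat q (m + size p) G) e.
Proof.
elim: p m e => [|b p IH] m e /=; first by rewrite addn0.
case: b; [apply: eq_forall|apply: eq_exists] => a;
  by rewrite IH addSn addnS.
Qed.

Lemma psat_mono (T : Type) (p : seq bool) m G G' (e : nat -> T) :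
  (forall e', agree m e e' -> G e' -> G' e') -> psat p m G e -> psat p m G' e.
Proof.
elim: p m e => [|b p IH] m e /= h; first exact: h.
have {}IH a : psat p m.+1 G (ext e m a) -> psat p m.+1 G' (ext e m a).
  by apply: IH => e' ag; apply: h; apply: agree_ext ag.
by case: b => [h' a|[a h']]; [apply: IH|exists a; apply: IH].
Qed.

Lemma psat_elim (T : Type) (p : seq bool) m G (e : nat -> T) :
  psat p m G e -> exists2 e', agree m e e' & G e'.
Proof.
elim: p m e => [|b p IH] m e /=; first by exists e.
have {}IH a : psat p m.+1 G (ext e m a) -> exists2 e', agree m e e' & G e'.
  by case/IH=> e' ag; exists e' => //; apply: agree_ext ag.
(* Under a universal quantifier any element will do; [e 0] is one at hand. *)
by case: b => [h|[a h]]; [apply: (IH (e 0))|apply: (IH a)].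
Qed.

Lemma psat_nseq (T : Type) r m G (e e' : nat -> T) :
  (forall x, (x < m) || (m + r <= x) -> e x = e' x) -> G e' ->
  psat (nseq r false) m G e.
Proof.
elim: r m e => [|r IH] m e /= h Ge'.
  suff -> : e = e' by [].
  by apply/funext => x; apply: h; rewrite addn0; case: ltnP.
exists (e' m); apply: IH => // x hx; rewrite /ext; case: eqP => [-> //|/eqP xm].
apply: h; move: hx; rewrite addnS -addSn => /orP[|->]; rewrite ?orbT //.
by rewrite ltnS leq_eqVlt (negbTE xm) => /= ->.
Qed.

(** * Tuples stored in blocks of consecutive variables *)

Definition block (T : Type) (m r : nat) (e : nat -> T) : r.-tuple T :=
  [tuple e (m + l) | l < r].

Lemma block_agree (T : Type) (m m' r : nat) (e e' : nat -> T) :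
  m + r <= m' -> agree m' e e' -> block m r e = block m r e'.
Proof.
move=> hr h; apply: eq_mktuple => l; apply: h.
by apply: leq_trans hr; rewrite ltn_add2l.
Qed.

Lemma block_exists (T : Type) (m r : nat) (e : nat -> T) (t : r.-tuple T) :
  exists2 e', (forall x, (x < m) || (m + r <= x) -> e x = e' x) &
    block m r e' = t.
Proof.
exists (fun x => if m <= x then nth (e x) t (x - m) else e x).
  move=> x; case: leqP => //= mx; rewrite -leq_subRL // => h.
  by rewrite nth_default // size_tuple.
apply: eq_from_tnth => l; rewrite tnth_mktuple leq_addr addKn.
by rewrite (tnth_nth (e (m + l))).
Qed.

(** * Terms of the expanded vocabulary and marked blocks *)

Fixpoint rename (L : vocabulary) (n : nat) (ar : 'I_n -> nat) (r : nat -> nat)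
    (t : term (expand L ar)) : term L :=
  match t with
  | Var x => Var (r x)
  | App f ts => @App L f (fun i => rename r (ts i))
  end.

Section Prenex.

Context {L : vocabulary} {n : nat} {ar : 'I_n -> nat}.

Definition interp (M : model L) := forall i : 'I_n, set ((ar i).-tuple M).

Lemma evalf_rename (M : model L) (P : interp M) (e : nat -> M) r
    (t : term (expand L ar)) :
  evalf (M := M) e (rename r t) = evalf (M := expand_model P) (e \o r) t.
Proof.
elim: t => //= f ts IH.
by congr (@fun_interp L M f); apply: eq_mktuple => i; rewrite IH.
Qed.

Lemma term_var_rename r (t : term (expand L ar)) x m :
  (forall y, r y < m) -> term_var x (rename r t) -> x < m.
Proof.
move=> hr; elim: t => [y|f ts IH] /=; first by move/eqP->.
by case/existsP => i /IH.
Qed.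

(* A mark (i, b, v) asks the tuple of variables starting at v to lie in P_i if
   b holds, and outside P_i otherwise. *)
Definition mark : eqType := ('I_n * bool * nat)%type.

Definition marks (M : model L) (P : interp M) (E : seq mark) (e : nat -> M) :=
  forall x, x \in E -> signed x.1.2 (P x.1.1 (block x.2 (ar x.1.1) e)).

(* [c i = Some true] guesses that P_i is full, [Some false] that it is empty, and
   [None] that it is neither. *)
Definition respects (c : 'I_n -> option bool) (M : model L) (P : interp M) :=
  forall i b, c i = Some b -> forall t, signed b (P i t).

Definition proper (c : 'I_n -> option bool) (M : model L) (P : interp M) :=
  forall i, c i = None -> forall b, exists t, signed b (P i t).

Lemma marks_cat (M : model L) (P : interp M) E1 E2 e :
  marks P (E1 ++ E2) e <-> marks P E1 e /\ marks P E2 e.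
Proof.
split=> [h|[h1 h2] x]; last by rewrite mem_cat => /orP[/h1|/h2].
by split=> x hx; apply: h; rewrite mem_cat hx ?orbT.
Qed.

Lemma marks_agree (M : model L) (P : interp M) E m e e' :
  (forall x, x \in E -> x.2 + ar x.1.1 <= m) -> agree m e e' ->
  marks P E e -> marks P E e'.
Proof. by move=> hE h hP x xE; rewrite -(block_agree (hE _ xE) h); apply: hP. Qed.

(** * Prenex forms with marks and their closure properties *)

Definition property := forall M : model L, interp M -> (nat -> M) -> Prop.

Definition local (m : nat) (F : property) :=
  forall M (P : interp M) e e', agree m e e' -> F M P e -> F M P e'.

(* Soundness is needed also when P is not proper: a satisfying team only
   determines P on the values of the marked tuples. *)
Variant prenex (c : 'I_n -> option bool) (m : nat) (F : property) : Prop :=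
  Prenex (p : seq bool) (q : exc L) (E : seq mark) of
    literal_only q &
    (forall x, exc_free x q -> x < m + size p) &
    (forall x, x \in E -> x.2 + ar x.1.1 <= m + size p) &
    (forall x, x \in E -> c x.1.1 = None) &
    (forall M (P : interp M), respects c P -> forall e,
      psat p m (fun e' => qsat e' q /\ marks P E e') e -> F M P e) &
    (forall M (P : interp M), respects c P -> proper c P -> forall e,
      F M P e -> psat p m (fun e' => qsat e' q /\ marks P E e') e) &
    (forall M (P : interp M), proper c P -> forall e, psat p m (marks P E) e).

Lemma prenex_iff c m (F F' : property) :
  (forall M (P : interp M) e, F M P e <-> F' M P e) ->
  prenex c m F -> prenex c m F'.
Proof.
move=> h [p q E lq fq bE cE sound compl dflt].
exists p q E => // M P rP; first by move=> e /(sound _ _ rP) /h.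
by move=> pP e /h; apply: compl.
Qed.

Lemma prenex_literal c m b (a : atom L) :
  (forall x, atom_var x a -> x < m) ->
  prenex c m (fun M P e => signed b (atomf e a)).
Proof.
move=> ha; exists [::] (ELit b a) [::] => //=; first by rewrite addn0.
by move=> M P rP e [].
Qed.

(** If [c] makes a guess about [P_i], the literal has a constant truth value. Otherwise its
    arguments are copied into a fresh existential block, whose single mark carries the sign. *)
Lemma prenex_rel c m b (i : 'I_n) (ts : 'I_(ar i) -> term L) :
  0 < m -> (forall l x, term_var x (ts l) -> x < m) ->
  prenex c m (fun M P e => signed b (P i [tuple evalf e (ts l) | l < ar i])).
Proof.
move=> m0 hts; case ci: (c i) => [b'|].
  (* A literal of sign [b] has truth value [b == b'] when [P_i] is constantly [b']. *)
  have h0 M (P : interp M) : respects c P ->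
      forall e, signed (b == b') True <->
        signed b (P i [tuple evalf (M := M) e (ts l) | l < ar i]).
    by move=> rP e; have := rP i b' ci [tuple evalf e (ts l) | l < ar i];
      case: b; case: b' {ci} => /=; tauto.
  exists [::] (ELit (b == b') (Eq (Var 0) (Var 0))) [::] => //=.
  - by move=> x; rewrite orbb addn0 => /eqP->.
  - move=> M P rP e [h _]; apply/(h0 M P rP).
    by move: h; case: (b == b') => /=; tauto.
  - move=> M P rP pP e /(h0 M P rP) h; split=> //.
    by move: h; case: (b == b') => /=; tauto.
pose q := exc_all (fun l : 'I_(ar i) => ELit true (Eq (Var (m + l)) (ts l)))
            (enum 'I_(ar i)).
have qE (M : model L) (e : nat -> M) :
    qsat e q <-> block m (ar i) e = [tuple evalf e (ts l) | l < ar i].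
  split=> [/qsat_all h|h].
    by apply: eq_mktuple => l; apply: h; rewrite mem_enum.
  apply/qsat_all => l _ /=.
  by have := congr1 (fun t => tnth t l) h; rewrite !tnth_mktuple.
have tsE (M : model L) (e e' : nat -> M) : agree m e e' ->
    [tuple evalf e (ts l) | l < ar i] = [tuple evalf e' (ts l) | l < ar i].
  move=> h; apply: eq_mktuple => l; apply: evalf_eq => x /hts; exact: h.
exists (nseq (ar i) false) q [:: (i, b, m)].
- by rewrite /q; elim: (enum _).
- move=> x; rewrite size_nseq => /exc_free_all[->|[l _ /=]].
    exact: ltn_addr.
  case/orP=> [/eqP->|/hts xm]; first by rewrite ltn_add2l.
  exact: ltn_addr.
- by move=> x; rewrite inE => /eqP-> /=; rewrite size_nseq.
- by move=> x; rewrite inE => /eqP->.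
- move=> M P rP e /psat_elim[e' he [/qE hq]] /(_ _ (mem_head _ _)) /=.
  by rewrite hq -(tsE _ _ _ he).
- move=> M P rP pP e h.
  have [e' he ht] := block_exists m e [tuple evalf e (ts l) | l < ar i].
  apply: (psat_nseq he); split.
    by apply/qE; rewrite ht; apply: tsE => x hx; apply: he; rewrite hx.
  by move=> x; rewrite inE => /eqP-> /=; rewrite ht.
(* The equations [q] are not demanded here, so any tuple on the required side of [P_i] may be stored
   in the block. *)
- move=> M P pP e; have [t ht] := pP i ci b.
  have [e' he et] := block_exists m e t.
  apply: (psat_nseq he) => x; rewrite inE => /eqP-> /=; by rewrite et.
Qed.

Lemma prenex_quant c m (b : bool) (F : property) :
  prenex c m.+1 F ->
  prenex c m (fun M P e =>
    if b then forall a, F M P (ext e m a) else exists a, F M P (ext e m a)).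
Proof.
case=> p q E lq fq bE cE sound compl dflt.
exists (b :: p) q E => //=; rewrite ?addnS //.
- move=> M P rP e; case: b => [h a|[a h]]; last exists a.
    exact: (sound _ _ rP).
  exact: (sound _ _ rP).
- move=> M P rP pP e; case: b => [h a|[a h]]; last exists a.
    exact: (compl _ _ rP pP).
  exact: (compl _ _ rP pP).
- by move=> M P pP e; case: b => [a|]; last exists (e 0); apply: (dflt _ _ pP).
Qed.

(** The prefixes are concatenated, so [F2] must be prenexed from [m + size p1] on, a bound known
    only once [F1] has been treated; hence the hypothesis for all [m']. Locality carries [F2] across
    the variables of [p1]. *)
Lemma prenex_and c m (F1 F2 : property) :
  local m F2 -> prenex c m F1 -> (forall m', m <= m' -> prenex c m' F2) ->
  prenex c m (fun M P e => F1 M P e /\ F2 M P e).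
Proof.
move=> loc [p1 q1 E1 lq1 fq1 bE1 cE1 sound1 compl1 dflt1].
case/(_ (m + size p1) (leq_addr _ _)) => p2 q2 E2 lq2 fq2 bE2 cE2 sound2 compl2 dflt2.
have le1 x : x <= m + size p1 -> x <= m + size p1 + size p2.
  by move/leq_trans; apply; rewrite leq_addr.
have q1P (M : model L) (e e' : nat -> M) : agree (m + size p1) e e' ->
    qsat e q1 -> qsat e' q1.
  by move=> h; apply: qsat_eq => x /fq1; apply: h.
have E1P (M : model L) (P : interp M) e e' : agree (m + size p1) e e' ->
    marks P E1 e -> marks P E1 e' := marks_agree bE1.
exists (p1 ++ p2) (EAnd q1 q2) (E1 ++ E2); rewrite ?size_cat ?addnA.
- by rewrite /= lq1.
- by move=> x /= /orP[/fq1 /le1|/fq2].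
- by move=> x; rewrite mem_cat => /orP[/bE1 /le1|/bE2].
- by move=> x; rewrite mem_cat => /orP[/cE1|/cE2].
- move=> M P rP e; rewrite psat_cat => h; split.
    apply: (sound1 _ _ rP); apply: psat_mono h => e' _ /psat_elim[e'' ag].
    move=> [[/= h1 _] /marks_cat[h2 _]].
    by split; [apply: q1P h1|apply: E1P h2]; apply: agree_sym.
  have [e' ag {}h] := psat_elim h; apply: loc (agree_sym ag) _.
  apply: (sound2 _ _ rP); apply: psat_mono h => e'' _ [[_ ?] /marks_cat[]].
  by split.
- move=> M P rP pP e [/(compl1 _ _ rP pP) h1 h2]; rewrite psat_cat.
  apply: psat_mono h1 => e' ag [hq1 hE1].
  have := compl2 _ _ rP pP _ (loc _ _ _ _ ag h2); apply: psat_mono => e'' ag' [? ?].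
  split; first by split=> //; apply: q1P hq1.
  by apply/marks_cat; split=> //; apply: E1P hE1.
- move=> M P pP e; rewrite psat_cat; apply: psat_mono (dflt1 _ _ pP e).
  move=> e' _ hE1; apply: psat_mono (dflt2 _ _ pP e') => e'' ag hE2.
  by apply/marks_cat; split=> //; apply: E1P hE1.
Qed.

(* The marks of both disjuncts have to hold simultaneously; those of the
   disjunct that fails are met by default values, which exist as P is proper. *)
Lemma prenex_or c m (F1 F2 : property) :
  local m F2 -> prenex c m F1 -> (forall m', m <= m' -> prenex c m' F2) ->
  prenex c m (fun M P e => F1 M P e \/ F2 M P e).
Proof.
move=> loc [p1 q1 E1 lq1 fq1 bE1 cE1 sound1 compl1 dflt1].
case/(_ (m + size p1) (leq_addr _ _)) => p2 q2 E2 lq2 fq2 bE2 cE2 sound2 compl2 dflt2.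
have le1 x : x <= m + size p1 -> x <= m + size p1 + size p2.
  by move/leq_trans; apply; rewrite leq_addr.
have q1P (M : model L) (e e' : nat -> M) : agree (m + size p1) e e' ->
    qsat e q1 -> qsat e' q1.
  by move=> h; apply: qsat_eq => x /fq1; apply: h.
have E1P (M : model L) (P : interp M) e e' : agree (m + size p1) e e' ->
    marks P E1 e -> marks P E1 e' := marks_agree bE1.
exists (p1 ++ p2) (EOr q1 q2) (E1 ++ E2); rewrite ?size_cat ?addnA.
- by rewrite /= lq1.
- by move=> x /= /orP[/fq1 /le1|/fq2].
- by move=> x; rewrite mem_cat => /orP[/bE1 /le1|/bE2].
- by move=> x; rewrite mem_cat => /orP[/cE1|/cE2].
- move=> M P rP e; rewrite psat_cat => h.
  (* If [F2] fails at [e], by locality it fails at every [e'] reached through [p1]. Were [q1] or a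
     mark of [E1] to fail at [e'], every branch through [p2] would have to use [q2], and soundness
     would yield [F2]. *)
  have [hF2|nF2] := pselect (F2 M P e); [by right|left].
  apply: (sound1 _ _ rP); apply: psat_mono h => e' ag h.
  have [//|nG1] := pselect (qsat e' q1 /\ marks P E1 e').
  case: nF2; apply: loc (agree_sym ag) _; apply: (sound2 _ _ rP).
  apply: psat_mono h => e'' ag' [hq /marks_cat[hE1 hE2]]; split=> //.
  case: hq => // hq1; case: nG1.
  by split; [apply: q1P hq1|apply: E1P hE1]; apply: agree_sym.
- move=> M P rP pP e; rewrite psat_cat => -[/(compl1 _ _ rP pP) h1|h2].
    apply: psat_mono h1 => e' ag [hq1 hE1].
    apply: psat_mono (dflt2 _ _ pP e') => e'' ag' hE2.
    split; first by left; apply: q1P hq1.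
    by apply/marks_cat; split=> //; apply: E1P hE1.
  apply: psat_mono (dflt1 _ _ pP e) => e' ag hE1.
  have := compl2 _ _ rP pP _ (loc _ _ _ _ ag h2); apply: psat_mono => e'' ag' [? ?].
  by split; [right|apply/marks_cat; split=> //; apply: E1P hE1].
- move=> M P pP e; rewrite psat_cat; apply: psat_mono (dflt1 _ _ pP e).
  move=> e' _ hE1; apply: psat_mono (dflt2 _ _ pP e') => e'' ag hE2.
  by apply/marks_cat; split=> //; apply: E1P hE1.
Qed.

(** * Prenexing the matrix of the second order sentence *)

Definition truth (b : bool) (r : nat -> nat) (d : fo (expand L ar)) : property :=
  fun M P e => signed b (fsat (M := expand_model P) (e \o r) d).

Lemma truth_local b r d m : (forall x, r x < m) -> local m (truth b r d).
Proof. by move=> hr M P e e' h; rewrite /truth (agree_comp hr h). Qed.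

(** Negation only flips the sign [b], so negation normal form arises on the way: for [b = false] the
    connectives and the quantifiers are dualized. A quantifier over [y] becomes one over [m], with
    [r] redirected at [y], which keeps the prefix variables consecutive. *)
Lemma prenex_truth c (d : fo (expand L ar)) b r m :
  (forall x, r x < m) -> prenex c m (truth b r d).
Proof.
elim: d b r m => [a|d IH|d1 IH1 d2 IH2|d1 IH1 d2 IH2|y d IH|y d IH] b r m hr.
- case: a => [t u|[R|i] ts].
  + apply: (prenex_iff _ (@prenex_literal c m b (Eq (rename r t) (rename r u)) _)).
      by move=> M P e; rewrite /truth /= !(evalf_rename P).
    by move=> x /= /orP[] /term_var_rename; apply.
  + apply: (prenex_iff _
      (@prenex_literal c m b (@Rel L R (fun l => rename r (ts l))) _)).
      move=> M P e; rewrite /truth /=.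
      suff -> : [tuple evalf (M := M) e (rename r (ts l)) | l < rel_arity R] =
        [tuple evalf (M := expand_model P) (e \o r) (ts l) | l < rel_arity R] by [].
      by apply: eq_mktuple => l; rewrite (evalf_rename P).
    by move=> x /= /existsP[l] /term_var_rename; apply.
  + apply: (prenex_iff _
      (@prenex_rel c m b i (fun l => rename r (ts l)) _ _)).
    * move=> M P e; rewrite /truth /=.
      suff -> : [tuple evalf (M := M) e (rename r (ts l)) | l < ar i] =
        [tuple evalf (M := expand_model P) (e \o r) (ts l) | l < ar i] by [].
      by apply: eq_mktuple => l; rewrite (evalf_rename P).
    * exact: leq_ltn_trans (hr 0).
    * by move=> l x /term_var_rename; apply.
- apply: prenex_iff (IH (~~ b) r m hr) => M P e; rewrite /truth /=.
  by case: b => //=; split=> [h|/contrapT].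
- have hr' m' : m <= m' -> forall x, r x < m'.
    by move=> le x; apply: leq_trans (hr x) le.
  case: b.
    by apply: (prenex_and (truth_local (b := true) (d := d2) hr)
      (IH1 true r m hr)) => m' /hr'; apply: IH2.
  apply: prenex_iff (prenex_or (truth_local (b := false) (d := d2) hr)
      (IH1 false r m hr) _); last by move=> m' /hr'; apply: IH2.
  by move=> M P e; rewrite /truth /= not_andE.
- have hr' m' : m <= m' -> forall x, r x < m'.
    by move=> le x; apply: leq_trans (hr x) le.
  case: b.
    by apply: (prenex_or (truth_local (b := true) (d := d2) hr)
      (IH1 true r m hr)) => m' /hr'; apply: IH2.
  apply: prenex_iff (prenex_and (truth_local (b := false) (d := d2) hr)
      (IH1 false r m hr) _); last by move=> m' /hr'; apply: IH2.
  by move=> M P e; rewrite /truth /= not_orE.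
- have eE (M : model L) (e : nat -> M) a := ext_comp e y a hr.
  apply: prenex_iff (prenex_quant (~~ b) (IH b _ _ (ext_lt y hr))) => M P e.
  rewrite /truth /=; case: b => /=; last rewrite -forallNE.
    by split=> -[a h]; exists a; move: h; rewrite eE.
  by split=> h a; have := h a; rewrite eE.
- have eE (M : model L) (e : nat -> M) a := ext_comp e y a hr.
  apply: prenex_iff (prenex_quant b (IH b _ _ (ext_lt y hr))) => M P e.
  rewrite /truth /=; case: b => /=; last rewrite -existsNE.
    by split=> h a; have := h a; rewrite eE.
  by split=> -[a h]; exists a; move: h; rewrite eE.
Qed.

(** * Exclusion atoms for the marks and the translated formula *)

Definition exclusion (xy : mark * mark) : exc L :=
  let: (x, y) := xy in
  if [&& x.1.1 == y.1.1, x.1.2 & ~~ y.1.2] then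
    EExcl (fun l : 'I_(ar x.1.1) => Var (x.2 + l))
          (fun l : 'I_(ar x.1.1) => Var (y.2 + l))
  else ETrue L.

(** The atom compares values at possibly different assignments; this is what lets a single relation
    serve the whole team. *)
Lemma exc_sat_exclusion (M : model L) (X : team M) (i : 'I_n) (v w : nat) :
  exc_sat X (exclusion (i, true, v, (i, false, w))) <->
  forall s s', X s -> X s' ->
    block v (ar i) (env s) <> block w (ar i) (env s').
Proof.
have bE u (s : assignment M) :
    eval_tuple s (fun l : 'I_(ar i) => Var (u + l)) = block u (ar i) (env s).
  by apply: eq_mktuple.
rewrite /exclusion /= eqxx /=; split=> [h s s' Xs Xs' vw|h].
  suff : set0 (block v (ar i) (env s)) by [].
  by rewrite -h; split; [exists s|exists s'] => //; rewrite bE.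
apply/seteqP; split=> // t [[s Xs <-] [s' Xs']]; rewrite !bE => /esym.
exact: h.
Qed.

Lemma exc_of_prenex c m k (F : property) :
  0 < m -> (forall i, ar i <= k) -> prenex c m F ->
  exists phi : exc L,
    [/\ forall x, exc_free x phi -> x < m, exc_in k phi,
        forall (M : model L) (X : team M), exc_sat X phi ->
          exists P : interp M, forall s, X s -> F M P (env s) &
        forall (M : model L) (P : interp M), respects c P -> proper c P ->
          forall X : team M, (forall s, X s -> F M P (env s)) -> exc_sat X phi].
Proof.
move=> m0 hk [p q E lq fq bE cE sound compl _].
exists (quantify p m
  (EAnd q (exc_all exclusion [seq (x, y) | x <- E, y <- E]))); split.
- apply: exc_free_quantify => x /= /orP[/fq //|/exc_free_all[->|]].
    exact: ltn_addr.
  case=> _ /allpairsP[[u v] /= [uE vE ->]] /=.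
  case: ifP => [/andP[/eqP uv _]|_ /=]; last first.
    by rewrite orbb => /eqP->; exact: ltn_addr.
  case/orP=> /existsP[l /eqP->].
    by apply: leq_trans (bE _ uE); rewrite ltn_add2l.
  by apply: leq_trans (bE _ vE); rewrite ltn_add2l -uv.
- rewrite exc_in_quantify /= exc_in_literal_only // exc_in_all // => -[x y] /=.
  by case: ifP => //= _; apply: hk.
- move=> M X /exc_sat_quantify_elim[Y [hq /exc_sat_all hE] hY].
  (* A guessed relation is made constant, as [respects] demands; any other consists of the values of
     its positive blocks in [Y]. Positive marks then hold by definition, negative ones by
     exclusion. *)
  pose P : interp M := fun i t =>
    if c i is Some b then b : Prop
    else exists s v, [/\ Y s, (i, true, v) \in E & block v (ar i) (env s) = t].
  exists P => s Xs; apply: (sound M P).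
    by move=> i b ci t; rewrite /P ci; case: b {ci} => /=.
  apply: hY Xs => {}s Ys; split.
    by move/(exc_sat_literal_only _ lq): hq; apply.
  move=> [[i b] v] xE /=; rewrite /P (cE _ xE : c i = None).
  case: b xE => xE /=; first by exists s, v.
  case=> s' [w [Ys' wE]].
  have /exc_sat_exclusion h := hE _ (allpairs_f pair wE xE).
  exact: h.
- move=> M P rP pP X hX.
  apply: (exc_sat_quantify_intro (G := fun e => qsat e q /\ marks P E e)).
    move=> Y hY; split; first by apply/(exc_sat_literal_only _ lq) => s /hY[].
    apply/exc_sat_all => _ /allpairsP[[[[i b] v] [[i' b'] w]] /= [uE vE ->]].
    have [|/negbTE ne] := boolP [&& i == i', b & ~~ b']; last first.
      by rewrite /exclusion /= ne.
    case/and3P=> /eqP ii hb hb'; move: uE vE.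
    rewrite -{}ii {i'} (negbTE hb') {}hb => uE vE.
    (* A common value would lie in the relation by the first mark and outside it by the second. *)
    apply/exc_sat_exclusion => s s' /hY[_ /(_ _ uE) /= h1] /hY[_ /(_ _ vE) /= h2].
    by move=> vw; apply: h2; rewrite -vw.
  by move=> s Xs; apply: (compl _ _ rP pP); apply: hX.
Qed.

End Prenex.

(** * Disjunction over the guesses: full, empty or proper relations *)

Theorem theorem1 (k : nat) (L : vocabulary) (Phi : eso L) :
  1 <= k -> eso_sentence Phi -> eso_in k Phi ->
  exists phi : exc L,
    [/\ exc_sentence phi, exc_in k phi &
        forall M : model L, exc_true M phi <-> eso_true M Phi].
Proof.
case: Phi => n ar d _ sd kd.
(* [d] has no free variables, so its truth depends neither on [e] nor on the constant renaming. *)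
have F0 M (P : interp M) e :
    truth true (fun=> 0) d P e <->
    fo_sat (empty_assignment (expand_model P)) d.
  rewrite fo_sat_env; apply: fsat_eq => x hx.
  by have := sd x; rewrite /= hx.
(* Variable 0 is reserved: all source variables are initially sent to it, and the prefixes start at
   1. *)
have h c := exc_of_prenex (ltn0Sn 0) kd
  (prenex_truth c d true (fun _ => ltn0Sn 0)).
have {h}[f hf] := choice (fun c : {ffun 'I_n -> option bool} => h c).
(* The outer quantifier binds the only variable that can be free in the disjuncts. Guesses are
   finite functions, so they can be enumerated. *)
exists (EEx 0 (exc_any f (enum {ffun 'I_n -> option bool}))); split.
- move=> x; apply/negP => /= /andP[x0] /exc_free_any[x00|[c _]].
    by rewrite x00 in x0.
  by case: (hf c) => hx _ _ _ /hx; rewrite ltnS leqn0 (negbTE x0).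
- by rewrite /= exc_in_any // => c; case: (hf c).
move=> M; split.
  move=> [G [hG]] /exc_sat_any_elim[].
    have [a Ga] := hG _ erefl.
    by exists (upd (empty_assignment M) 0 a), (empty_assignment M), a.
  move=> c [Y [[s Ys]]]; case: (hf c) => _ _ hc _ /hc[P /(_ _ Ys) /F0 hP].
  by exists P.
move=> [P /F0 hP].
(* The guess that is correct for [P]: [None] is left for relations neither full nor empty, which
   gives [proper]. *)
pose c := [ffun i => if `[< forall t, P i t >] then Some true
                     else if `[< forall t, ~ P i t >] then Some false else None].
exists (fun=> setT); split; first by move=> s _; exists (Defs.point M).
apply: (@exc_sat_any_intro _ _ _ _ _ _ c); first by rewrite mem_enum.
case: (hf c) => _ _ _ /(_ M P); apply.
- move=> i b; rewrite ffunE; case: asboolP => [h [<-] //|_].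
  by case: asboolP => // h [<-].
- move=> i; rewrite ffunE; case: asboolP => // /existsNP[t nt].
  case: asboolP => // /existsNP[t' /contrapT ht'] _ [|].
    by exists t'.
  by exists t.
- by move=> s _; apply: hP.
Qed.
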